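(* Let $L$ be a loop and $G$ a middle and right nuclear normal subgroup of $L$. Then $L$ has a factor-free Schreier decomposition with respect to $G$ if and only if $L$ contains a left transversal $\Sigma$ of $L/G$ which is a subloop of $L$ isomorphic to $L/G$.
   Context: A subgroup $G$ of a loop $L$ is middle (right) nuclear if it is contained in the middle nucleus $\{u: xu\cdot y=x\cdot uy\ \forall x,y\in L\}$ (right nucleus $\{u: xy\cdot u=x\cdot yu\ \forall x,y\in L\}$). A left transversal of $L/G$ is a subset of $L$ consisting of exactly one representative of each left coset of $G$ and containing the identity of $L$. Let $K$ be a loop with identity $\epsilon$ and $e$ the identity of $G$. For maps $f:K\times K\to G$ and $\Theta:K\to\mathrm{Aut}(G)$ with $f(\sigma,\epsilon)=f(\epsilon,\sigma)=e$ and $\Theta_\epsilon=\mathrm{Id}$, the Schreier extension $K\times_f^{\Theta}G$ is the loop on $K\times G$ with multiplication $(\sigma,s)(\tau,t)=(\sigma\tau,f(\sigma,\tau)\Theta_\tau(s)t)$. It is factor-free if $f(\sigma,\tau)=e$ for all $\sigma,\tau\in K$. A Schreier decomposition of $L$ with respect to $G$ is an isomorphism $\mathcal{F}$ of some Schreier extension $K\times_f^{\Theta}G$ onto $L$ with $\mathcal{F}(\epsilon,t)=t$ for all $t\in G$; it is called factor-free if the Schreier extension is. *)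

(* Defs.v *)
From HB Require Import structures.
From mathcomp Require Import all_boot.
From mathcomp Require Import boolp classical_sets.

Set Implicit Arguments.
Unset Strict Implicit.
Unset Printing Implicit Defensive.

Local Open Scope classical_set_scope.
Local Open Scope group_scope.

(* The choice structure inherited from umagmaType is no restriction: boolp
   provides one on every type. *)
HB.mixin Record UMagma_isLoop L of UMagma L := {
  ldiv_unique : forall a b : L, exists! y : L, a * y = b;
  rdiv_unique : forall a b : L, exists! x : L, x * a = b
}.

#[short(type="loopType")]
HB.structure Definition Loop := {L of UMagma L & UMagma_isLoop L}.

Definition isomorphic (L M : loopType) : Prop :=
  exists phi : {multiplicative L -> M}, bijective phi.

Section LoopTheory.
Variable L : loopType.
Implicit Types (a b x y : L) (A B : set L).

Lemma loop_mulgI a : injective (mul a).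
Proof.
move=> x y xy; have [z [_ zu]] := ldiv_unique a (a * y).
by rewrite -(zu x xy) -(zu y erefl).
Qed.

Lemma loop_mulIg a : injective (mul^~ a).
Proof.
move=> x y /= xy; have [z [_ zu]] := rdiv_unique a (y * a).
by rewrite -(zu x xy) -(zu y erefl).
Qed.

Definition lcoset x A : set L := [set x * a | a in A].
Definition rcoset A x : set L := [set a * x | a in A].

Definition middle_nucleus : set L := [set u | forall x y, x * u * y = x * (u * y)].
Definition right_nucleus : set L := [set u | forall x y, x * y * u = x * (y * u)].

Record subloop := Subloop {
  subloop_set :> set L;
  subloop1 : subloop_set 1;
  subloopM : forall x y, subloop_set x -> subloop_set y -> subloop_set (x * y);
  subloop_ldiv : forall a b y,
    subloop_set a -> subloop_set b -> a * y = b -> subloop_set y;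
  subloop_rdiv : forall a b x,
    subloop_set a -> subloop_set b -> x * a = b -> subloop_set x
}.

Record subgroup := Subgroup {
  subgroup_subloop :> subloop;
  subgroupA : forall x y z, subloop_set subgroup_subloop x ->
    subloop_set subgroup_subloop y -> subloop_set subgroup_subloop z -> x * (y * z) = x * y * z
}.

Definition normal_subloop (N : subloop) : Prop :=
  [/\ forall x, lcoset x N = rcoset N x,
      forall x y, rcoset (lcoset x N) y = lcoset x (rcoset N y)
    & forall x y, lcoset x (lcoset y N) = lcoset (x * y) N].

Definition left_transversal (N : subloop) (S : set L) : Prop :=
  S 1 /\ forall x, exists! s, S s /\ lcoset x N s.

End LoopTheory.
Arguments middle_nucleus L : clear implicits.
Arguments right_nucleus L : clear implicits.

Section SubloopStructure.
Variables (L : loopType) (S : subloop L).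

Definition subloop_one : S := exist _ 1 (mem_set (subloop1 S)).
Definition subloop_mul (u v : S) : S :=
  exist _ (val u * val v)
    (mem_set (subloopM (set_mem (valP u)) (set_mem (valP v)))).

Lemma subloop_mul1g : left_id subloop_one subloop_mul.
Proof. by move=> u; apply/val_inj; rewrite /= mul1g. Qed.

Lemma subloop_mulg1 : right_id subloop_one subloop_mul.
Proof. by move=> u; apply/val_inj; rewrite /= mulg1. Qed.

#[warning="-HB.no-new-instance"]
HB.instance Definition _ := Choice.on (set_type S).
HB.instance Definition _ := hasMul.Build (set_type S) subloop_mul.
HB.instance Definition _ :=
  Magma_isUMagma.Build (set_type S) subloop_mul1g subloop_mulg1.

Lemma subloop_ldiv_unique (a b : S) : exists! y : S, a * y = b.
Proof.
have [y [ayb yu]] := ldiv_unique (val a) (val b).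
have Sy := subloop_ldiv (set_mem (valP a)) (set_mem (valP b)) ayb.
exists (exist _ y (mem_set Sy)); split; first exact/val_inj.
by move=> z azb; apply/val_inj/yu; rewrite -azb.
Qed.

Lemma subloop_rdiv_unique (a b : S) : exists! x : S, x * a = b.
Proof.
have [x [xab xu]] := rdiv_unique (val a) (val b).
have Sx := subloop_rdiv (set_mem (valP a)) (set_mem (valP b)) xab.
exists (exist _ x (mem_set Sx)); split; first exact/val_inj.
by move=> z zab; apply/val_inj/xu; rewrite -zab.
Qed.

HB.instance Definition _ :=
  UMagma_isLoop.Build (set_type S) subloop_ldiv_unique subloop_rdiv_unique.

End SubloopStructure.

Section SubgroupStructure.
Variables (L : loopType) (G : subgroup L).

Lemma subgroup_mulgA : associative (@mul (set_type G)).
Proof.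
by move=> x y z; apply/val_inj/subgroupA; apply: set_mem; apply: valP.
Qed.

HB.instance Definition _ := Magma_isSemigroup.Build (set_type G) subgroup_mulgA.

Definition subgroup_inv (x : G) : G := sval (cid (rdiv_unique x 1)).

Lemma subgroup_mulVg : left_inverse 1 subgroup_inv (@mul (set_type G)).
Proof. by move=> x; rewrite /subgroup_inv; case: cid => y []. Qed.

Lemma subgroup_mulgV : right_inverse 1 subgroup_inv (@mul (set_type G)).
Proof.
move=> x; apply: (@loop_mulgI _ (subgroup_inv x)).
by rewrite mulgA subgroup_mulVg mul1g mulg1.
Qed.

HB.instance Definition _ := hasInv.Build (set_type G) subgroup_inv.
HB.instance Definition _ :=
  Monoid_isGroup.Build (set_type G) subgroup_mulVg subgroup_mulgV.

End SubgroupStructure.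

Definition lcosets (L : loopType) (N : subloop L) : set (set L) :=
  [set lcoset x N | x in [set: L]].

Definition quotient (L : loopType) (N : subloop L) of normal_subloop N : Type :=
  set_type (lcosets N).

Section QuotientStructure.
Variables (L : loopType) (N : subloop L) (nN : normal_subloop N).

HB.instance Definition _ := Choice.on (quotient nN).

Lemma lcoset_refl x : lcoset x N x.
Proof. by exists 1; [exact: subloop1 | rewrite mulg1]. Qed.

Lemma lcoset_eq x z : lcoset x N z -> lcoset z N = lcoset x N.
Proof.
case: nN => _ _ nM [n Nn <-]; rewrite -nM; congr lcoset.
apply/seteqP; split=> [_ [m Nm <-]|m Nm]; first exact: subloopM.
have [k [nk _]] := ldiv_unique n m.
by exists k => //; apply: subloop_ldiv nk.
Qed.

Lemma lcoset_setM x y :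
  [set u * v | u in lcoset x N & v in lcoset y N] = lcoset (x * y) N.
Proof.
have [nC nA nM] := nN; apply/seteqP; split=> [_ [u xu [v yv <-]]|_ [n Nn <-]].
  have: rcoset (lcoset x N) v (u * v) by exists u.
  by rewrite nA -nC nM -(nM x v) (lcoset_eq yv) nM.
have: lcoset x (lcoset y N) (x * y * n) by rewrite nM; exists n.
by case=> w yw <-; exists x; [exact: lcoset_refl | exists w].
Qed.

Definition coset_proj (x : L) : quotient nN :=
  exist _ (lcoset x N) (mem_set (imageT (fun y => lcoset y N) x)).

Lemma coset_projP (C : quotient nN) : exists x, C = coset_proj x.
Proof.
by have /set_mem[x _ xC] := valP C; exists x; apply/val_inj; rewrite -xC.
Qed.

Lemma coset_proj_eq x z : lcoset x N z -> coset_proj z = coset_proj x.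
Proof. by move=> xz; apply/val_inj/lcoset_eq. Qed.

(* Product of cosets as subsets of L, (xN)(yN) = (xy)N. *)
Lemma coset_mul_subproof (C D : quotient nN) :
  [set u * v | u in val C & v in val D] \in lcosets N.
Proof.
have [[x ->] [y ->]] := (coset_projP C, coset_projP D).
by rewrite /= lcoset_setM; apply/mem_set; exists (x * y).
Qed.

Definition coset_mul (C D : quotient nN) : quotient nN :=
  exist (fun E => E \in lcosets N) _ (coset_mul_subproof C D).

Lemma coset_projM x y :
  coset_mul (coset_proj x) (coset_proj y) = coset_proj (x * y).
Proof. exact/val_inj/lcoset_setM. Qed.

Lemma coset_mul1g : left_id (coset_proj 1) coset_mul.
Proof. by move=> C; have [x ->] := coset_projP C; rewrite coset_projM mul1g. Qed.

Lemma coset_mulg1 : right_id (coset_proj 1) coset_mul.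
Proof. by move=> C; have [x ->] := coset_projP C; rewrite coset_projM mulg1. Qed.

HB.instance Definition _ := hasMul.Build (quotient nN) coset_mul.
HB.instance Definition _ :=
  Magma_isUMagma.Build (quotient nN) coset_mul1g coset_mulg1.

Lemma coset_proj_is_multiplicative : {morph coset_proj : x y / x * y}.
Proof. by move=> x y; rewrite -coset_projM. Qed.

HB.instance Definition _ :=
  isMultiplicative.Build L (quotient nN) coset_proj coset_proj_is_multiplicative.

Lemma coset_proj_inv x z : coset_proj z = coset_proj x -> lcoset x N z.
Proof. by move=> /(congr1 val)/= <-; exact: lcoset_refl. Qed.

Lemma quotient_ldiv_unique (A B : quotient nN) : exists! Y : quotient nN, A * Y = B.
Proof.
have [[a ->] [b ->]] := (coset_projP A, coset_projP B).
have [y [ayb _]] := ldiv_unique a b; exists (coset_proj y).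
split=> [|Z]; first by rewrite -gmulfM ayb.
have [z ->] := coset_projP Z; rewrite -gmulfM.
move=> /coset_proj_inv; have [_ _ nM] := nN; rewrite -ayb -nM.
by case=> w yw /loop_mulgI <-; apply/esym/coset_proj_eq.
Qed.

Lemma quotient_rdiv_unique (A B : quotient nN) : exists! X : quotient nN, X * A = B.
Proof.
have [[a ->] [b ->]] := (coset_projP A, coset_projP B).
have [x [xab _]] := rdiv_unique a b; exists (coset_proj x).
split=> [|Z]; first by rewrite -gmulfM xab.
have [z ->] := coset_projP Z; rewrite -gmulfM.
move=> /coset_proj_inv; have [nC nA nM] := nN; rewrite -xab -nM nC -nA.
by case=> w xw /loop_mulIg <-; apply/esym/coset_proj_eq.
Qed.

HB.instance Definition _ :=
  UMagma_isLoop.Build (quotient nN) quotient_ldiv_unique quotient_rdiv_unique.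

End QuotientStructure.
Arguments coset_proj {L N} nN x.

Record automorphism (G : groupType) := Automorphism {
  aut_fun :> {multiplicative G -> G};
  aut_bij : bijective aut_fun
}.

Record schreier_data (K : loopType) (G : groupType) := SchreierData {
  sch_f : K -> K -> G;
  sch_Theta : K -> automorphism G;
  sch_f1r : forall sigma, sch_f sigma 1 = 1;
  sch_f1l : forall sigma, sch_f 1 sigma = 1;
  sch_Theta1 : sch_Theta 1 =1 id
}.

Definition factor_free (K : loopType) (G : groupType) (D : schreier_data K G) :=
  forall sigma tau, sch_f D sigma tau = 1.

Definition schreier_ext (K : loopType) (G : groupType) of schreier_data K G : Type :=
  (K * G)%type.

Section SchreierStructure.
Variables (K : loopType) (G : groupType) (D : schreier_data K G).
Local Notation f := (sch_f D).
Local Notation Theta := (sch_Theta D).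

HB.instance Definition _ := Choice.on (schreier_ext D).

Definition schreier_mul (u v : schreier_ext D) : schreier_ext D :=
  (u.1 * v.1, f u.1 v.1 * Theta v.1 u.2 * v.2).
Definition schreier_one : schreier_ext D := (1, 1).

Lemma aut1 (phi : automorphism G) : phi 1 = 1.
Proof. by apply: (@mulgI _ (phi 1)); rewrite -gmulfM !mulg1. Qed.

Lemma schreier_mul1g : left_id schreier_one schreier_mul.
Proof. by case=> s t; rewrite /schreier_mul /= sch_f1l aut1 !mul1g. Qed.

Lemma schreier_mulg1 : right_id schreier_one schreier_mul.
Proof. by case=> s t; rewrite /schreier_mul /= sch_f1r sch_Theta1 !mulg1 mul1g. Qed.

HB.instance Definition _ := hasMul.Build (schreier_ext D) schreier_mul.
HB.instance Definition _ :=
  Magma_isUMagma.Build (schreier_ext D) schreier_mul1g schreier_mulg1.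

Lemma schreier_ldiv_unique (a b : schreier_ext D) :
  exists! y : schreier_ext D, a * y = b.
Proof.
case: a b => [a s] [b t]; have [y [ayb yu]] := ldiv_unique a b.
exists (y, (f a y * Theta y s)^-1 * t); split=> [|[z r] [azb]].
  by rewrite [LHS]/mul /= /schreier_mul /= ayb mulVKg.
by rewrite -(yu z azb) => <-; rewrite mulKg.
Qed.

Lemma schreier_rdiv_unique (a b : schreier_ext D) :
  exists! x : schreier_ext D, x * a = b.
Proof.
case: a b => [a s] [b t]; have [x [xab xu]] := rdiv_unique a b.
have [g Thg gTh] := aut_bij (Theta a).
exists (x, g ((f x a)^-1 * (t * s^-1))); split=> [|[z r] [zab]].
  by rewrite [LHS]/mul /= /schreier_mul /= xab gTh mulVKg mulgVK.
by rewrite -(xu z zab) => <-; rewrite mulgK mulKg Thg.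
Qed.

HB.instance Definition _ := UMagma_isLoop.Build (schreier_ext D)
  schreier_ldiv_unique schreier_rdiv_unique.

End SchreierStructure.

Definition schreier_decomposition (L : loopType) (G : subgroup L)
    (K : loopType) (D : schreier_data K (set_type G))
    (F : {multiplicative schreier_ext D -> L}) : Prop :=
  bijective F /\ forall t : G, F (1, t) = val t.

(* Main.v *)
(* If G is middle and right nuclear and S is a subloop transversal, then
   commuting s in G past t in S, s t = t Theta_t(s), gives
   (x s)(t r) = x (s (t r)) = x ((t Theta_t(s)) r) = (x t)(Theta_t(s) r),
   so (t, r) |-> t r is a factor-free decomposition with K = S. Conversely the
   elements F(k, 1) form the required transversal. A subloop transversal is
   always isomorphic to L/G, by restricting the projection. *)
From HB Require Import structures.
Require Import Defs.
From mathcomp Require Import all_boot.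
From mathcomp Require Import boolp classical_sets.

Set Implicit Arguments.
Unset Strict Implicit.
Unset Printing Implicit Defensive.

Local Open Scope classical_set_scope.
Local Open Scope group_scope.

(** Both elements represent the coset [lcoset x N], whose representative in [A] is unique. *)
Lemma left_transversal_inj (L : loopType) (N : subloop L) (A : set L) x y :
  left_transversal N A -> A x -> A y -> lcoset x N y -> x = y.
Proof.
move=> [_ /(_ x)[z [_ zu]]] Ax Ay xy.
by rewrite -(zu x (conj Ax (lcoset_refl N x))) (zu y).
Qed.

Section TransversalProjection.
Variables (L : loopType) (N : subloop L) (nN : normal_subloop N).
Variable S : subloop L.

Definition transversal_proj (u : set_type S) : quotient nN :=
  coset_proj nN (val u).

Lemma transversal_projM : {morph transversal_proj : u v / u * v}.
Proof. by move=> u v; rewrite /transversal_proj -gmulfM. Qed.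

HB.instance Definition _ :=
  isMultiplicative.Build (set_type S) (quotient nN) transversal_proj
    transversal_projM.

(** Existence of representatives makes the projection surjective, their uniqueness makes it
    injective. *)
Lemma left_transversal_isomorphic :
  left_transversal N S -> isomorphic (set_type S) (quotient nN).
Proof.
move=> trS; exists transversal_proj.
have /choice[g gP] : forall C : quotient nN, exists u, transversal_proj u = C.
  move=> C; have [x ->] := coset_projP C; have [_ /(_ x)[s [[Ss xs] _]]] := trS.
  by exists (exist _ s (mem_set Ss)); exact: coset_proj_eq.
exists g => // u; apply/val_inj/(left_transversal_inj trS); try exact: set_valP.
exact/(@coset_proj_inv _ _ nN)/esym/gP.
Qed.

End TransversalProjection.

Section FactorFreeToTransversal.
Variables (L : loopType) (G : subgroup L) (K : loopType).
Variables (D : schreier_data K (set_type G)).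
Variable F : {multiplicative schreier_ext D -> L}.
Hypotheses (decF : schreier_decomposition F) (ffD : factor_free D).

Lemma factor_free_mul (u v : schreier_ext D) :
  u * v = (u.1 * v.1, sch_Theta D v.1 u.2 * v.2).
Proof. by rewrite [LHS]/mul /= /schreier_mul ffD mul1g. Qed.

Definition section_set : set L := [set F (k, 1) | k in [set: K]].

Lemma section1 : section_set 1.
Proof. by exists 1 => //; case: decF => _ ->. Qed.

Lemma sectionM x y : section_set x -> section_set y -> section_set (x * y).
Proof.
move=> [k _ <-] [l _ <-]; exists (k * l) => //.
by rewrite -gmulfM factor_free_mul /= aut1 mulg1.
Qed.

(** In coordinates (k, 1)(m, r) = (km, r), so the divisor inherits the trivial second component of
    the product. *)
Lemma section_ldiv a b y :
  section_set a -> section_set b -> a * y = b -> section_set y.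
Proof.
have [[F' FK F'K] _] := decF.
move=> [k _ <-] [l _ <-]; rewrite -(F'K y); case: (F' y) => m r.
rewrite -gmulfM factor_free_mul /= aut1 mul1g => /(can_inj FK)[_ ->].
by exists m.
Qed.

Lemma section_rdiv a b x :
  section_set a -> section_set b -> x * a = b -> section_set x.
Proof.
have [[F' FK F'K] _] := decF.
move=> [k _ <-] [l _ <-]; rewrite -(F'K x); case: (F' x) => m r.
rewrite -gmulfM factor_free_mul /= mulg1 => /(can_inj FK)[_ Thr].
(* Here (m, r)(k, 1) = (mk, Theta_k(r)), so injectivity of Theta_k is what forces r = 1. *)
have -> : r = 1 by apply: (bij_inj (aut_bij (sch_Theta D k))); rewrite Thr aut1.
by exists m.
Qed.

Definition section_subloop : subloop L :=
  Subloop section1 sectionM section_ldiv section_rdiv.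

(** Since Theta_1 is the identity, right multiplication by [G] moves only the second coordinate.
    Hence the left cosets of [G] are the fibres of the first coordinate, and each meets the section
    once. *)
Lemma section_left_transversal : left_transversal G section_subloop.
Proof.
have [[F' FK F'K] FG] := decF.
have cosF k s (t : set_type G) : F (k, s) * val t = F (k, s * t).
  by rewrite -FG -gmulfM factor_free_mul /= mulg1 sch_Theta1.
split=> [|x]; first exact: section1.
rewrite -(F'K x); case: (F' x) => k s; exists (F (k, 1)); split.
  split; first by exists k.
  by exists (val s^-1); [exact: set_valP | rewrite cosF mulgV].
move=> _ [[l _ <-] [t Gt]].
have -> : t = val (exist _ t (mem_set Gt) : set_type G) by [].
by rewrite cosF => /(can_inj FK)[-> _].
Qed.

End FactorFreeToTransversal.

Section TransversalToFactorFree.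
Variables (L : loopType) (G : subgroup L).
Hypotheses (nG : normal_subloop G).
Hypotheses (mG : G `<=` middle_nucleus L) (rG : G `<=` right_nucleus L).

Let midA x y (u : set_type G) : x * val u * y = x * (val u * y).
Proof. exact: (mG (set_valP u)). Qed.

Let rightA x y (u : set_type G) : x * y * val u = x * (y * val u).
Proof. exact: (rG (set_valP u)). Qed.

Lemma twist_ex t (s : set_type G) : exists s' : set_type G, t * val s' = val s * t.
Proof.
have [nC _ _] := nG.
have : rcoset G t (val s * t) by exists (val s) => //; exact: set_valP.
by rewrite -nC => -[s' Gs' <-]; exists (exist _ s' (mem_set Gs')).
Qed.

Lemma untwist_ex t (s' : set_type G) : exists s : set_type G, val s * t = t * val s'.
Proof.
have [nC _ _] := nG.
have : lcoset t G (t * val s') by exists (val s') => //; exact: set_valP.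
by rewrite nC => -[s Gs <-]; exists (exist _ s (mem_set Gs)).
Qed.

(** In a group this is the conjugate t^-1 s t. Cancelling [t] shows that the chosen element is
    unique. *)
Definition twist t s : set_type G := sval (cid (twist_ex t s)).

Lemma twistP t s : t * val (twist t s) = val s * t.
Proof. by rewrite /twist; case: cid. Qed.

(** Writing r', s' for the twists, t(r's') = (tr')s' = (rt)s' = r(ts') = r(st) = (rs)t. The last
    equality is middle nuclearity of s, the other reassociations are right nuclearity of s'. *)
Lemma twistM t : {morph twist t : r s / r * s}.
Proof.
move=> r s; apply/val_inj/(@loop_mulgI _ t); rewrite twistP.
by rewrite /= -rightA twistP rightA twistP midA.
Qed.

HB.instance Definition _ t :=
  isMultiplicative.Build (set_type G) (set_type G) (twist t) (@twistM t).

Lemma twist_bij t : bijective (twist t).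
Proof.
have /choice[g gP] := untwist_ex t.
exists g => s; apply/val_inj.
  by apply/(@loop_mulIg _ t); rewrite gP twistP.
by apply/(@loop_mulgI _ t); rewrite twistP gP.
Qed.

Definition twist_aut t : automorphism (set_type G) :=
  @Automorphism (set_type G) (twist t) (twist_bij t).

Lemma twist1 : twist_aut 1 =1 id.
Proof. by move=> s; apply/val_inj; have := twistP 1 s; rewrite mul1g mulg1. Qed.

Variable S : subloop L.

(** The constant first field makes factor-freeness hold by computation. *)
Definition twist_data : schreier_data (set_type S) (set_type G) :=
  @SchreierData (set_type S) (set_type G) (fun _ _ => 1)
    (fun k => twist_aut (val k)) (fun=> erefl) (fun=> erefl) twist1.

Definition transversal_mul (u : schreier_ext twist_data) : L :=
  val u.1 * val u.2.

Lemma transversal_mulM : {morph transversal_mul : u v / u * v}.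
Proof.
move=> [k s] [l t]; rewrite factor_free_mul // /transversal_mul /=.
(* Fixing the last factor to [val l] keeps [midA] on the right-hand side, where (ks)l = k(sl) =
   k(ls') = (kl)s'. *)
by rewrite -!rightA (midA _ (val l)) -twistP -rightA.
Qed.

HB.instance Definition _ :=
  isMultiplicative.Build (schreier_ext twist_data) L transversal_mul
    transversal_mulM.

(** The product ks lies in the coset kG, so it determines its representative k, and then s by left
    cancellation. *)
Lemma transversal_mul_inj : left_transversal G S -> injective transversal_mul.
Proof.
move=> trS [k s] [l t]; rewrite /transversal_mul /= => kslt.
have cosE (x : L) (r : set_type G) : lcoset (x * val r) G = lcoset x G.
  by apply: lcoset_eq => //; exists (val r) => //; exact: set_valP.
have kl : k = l.
  apply/val_inj/(left_transversal_inj trS); try exact: set_valP.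
  by rewrite -(cosE _ s) kslt cosE; exact: lcoset_refl.
by rewrite kl in kslt *; congr pair; apply/val_inj/(loop_mulgI kslt).
Qed.

Lemma transversal_mul_decomposition : left_transversal G S ->
  schreier_decomposition (transversal_mul : {multiplicative _ -> _}).
Proof.
move=> trS; split=> [|t]; last by rewrite /= /transversal_mul mul1g.
have /choice[g gP] : forall x, exists u, transversal_mul u = x.
  move=> x; have [_ /(_ x)[k [[Sk xk] _]]] := trS.
  (* As xG = kG, the element x itself has the form ks with s in [G]. *)
  have := lcoset_refl G x; rewrite -(lcoset_eq nG xk) => -[s Gs <-].
  by exists (exist _ k (mem_set Sk), exist _ s (mem_set Gs)).
by exists g => // u; apply: (transversal_mul_inj trS).
Qed.

End TransversalToFactorFree.

Theorem theorem49 (L : loopType) (G : subgroup L) (nG : normal_subloop G)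
    (mG : G `<=` middle_nucleus L) (rG : G `<=` right_nucleus L) :
  (exists (K : loopType) (D : schreier_data K (set_type G))
      (F : {multiplicative schreier_ext D -> L}),
     schreier_decomposition F /\ factor_free D) <->
  (exists S : subloop L,
     left_transversal G S /\ isomorphic (set_type S) (quotient nG)).
Proof.
split=> [[K [D [F [decF ffD]]]]|[S [trS _]]].
  exists (section_subloop decF ffD).
  have trS := section_left_transversal decF ffD; split=> //.
  exact: left_transversal_isomorphic.
exists (set_type S), (twist_data nG mG rG S), (@transversal_mul _ _ nG mG rG S).
by split=> //; exact: transversal_mul_decomposition.
Qed.
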